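(* A hereditary graph class is subfactorial if and only if it is a function of $\mathcal{C}$.
   Context: All graphs are finite and simple; a class of graphs is a set of graphs closed under isomorphism; it is hereditary if closed under taking induced subgraphs. For a class $\mathcal{X}$, $\mathcal{X}^n$ is the set of graphs in $\mathcal{X}$ with vertex set $[n]$; a hereditary class is subfactorial if $|\mathcal{X}^n|=2^{o(n\log n)}$. $\mathcal{C}$ is the class of graphs consisting of one clique together with isolated vertices. For a graph $G$ and distinct vertices $u,w$, $G(u,w)=1$ if they are adjacent and $0$ otherwise. If $G,H_1,\dots,H_k$ are graphs on the same vertex set $V$, $G$ is a (boolean) function of $H_1,\dots,H_k$ if there is a boolean function $f:\{0,1\}^k\to\{0,1\}$ with $G(a,b)=f(H_1(a,b),\dots,H_k(a,b))$ for all distinct $a,b\in V$. A class $\mathcal{Y}$ is a $k$-function of $\mathcal{X}$ if every $G\in\mathcal{Y}$ is a function of at most $k$ graphs from $\mathcal{X}$ (on the vertex set of $G$); $\mathcal{Y}$ is a function of $\mathcal{X}$ if it is a $k$-function for some $k\in\mathbb{N}$. *)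

(* Defs.v *)
From HB Require Import structures.
From mathcomp Require Import all_boot all_order all_algebra.
From mathcomp Require Import all_classical all_reals all_analysis.

Set Implicit Arguments.
Unset Strict Implicit.
Unset Printing Implicit Defensive.

Import Order.TTheory GRing.Theory Num.Theory.
Import numFieldNormedType.Exports.

Local Open Scope classical_set_scope.
Local Open Scope ring_scope.

(* Adjacency is stored as a finite function, so that equality of graphs is
   extensional and the graphs on a given vertex set form a finType. *)
Definition simple_adj (T : finType) (a : {ffun T * T -> bool}) : bool :=
  [forall x, ~~ a (x, x)] && [forall x, forall y, a (x, y) == a (y, x)].

Record graph (T : finType) := Graph {
  adj_fun : {ffun T * T -> bool};
  adj_simple : simple_adj adj_fun
}.

HB.instance Definition _ (T : finType) := [isSub for @adj_fun T].
HB.instance Definition _ (T : finType) := [Finite of graph T by <:].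

Definition adj (T : finType) (G : graph T) : rel T :=
  fun x y => adj_fun G (x, y).

Coercion adj : graph >-> rel.

Definition graph_iso (T U : finType) (G : graph T) (H : graph U) : Prop :=
  exists2 f : T -> U, bijective f & forall x y, G x y = H (f x) (f y).

Fact induced_subproof (T : finType) (G : graph T) (A : {set T}) :
  simple_adj [ffun p : {x : T | x \in A} * {x : T | x \in A} =>
                G (val p.1) (val p.2)].
Proof.
have /andP[/forallP irr /forallP sym] := adj_simple G.
apply/andP; split; apply/forallP => x; first by rewrite ffunE; exact: irr.
apply/forallP => y; rewrite !ffunE.
exact: (forallP (sym (val x)) (val y)).
Qed.

Definition induced (T : finType) (G : graph T) (A : {set T}) :
  graph {x : T | x \in A} := Graph (induced_subproof G A).

Record graph_class := GraphClass {
  in_class :> forall T : finType, graph T -> Prop;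
  class_iso : forall (T U : finType) (G : graph T) (H : graph U),
    graph_iso G H -> in_class G -> in_class H
}.

Definition hereditary (X : graph_class) : Prop :=
  forall (T : finType) (G : graph T) (A : {set T}), X T G -> X _ (induced G A).

Definition slice (X : graph_class) (n : nat) : {set graph 'I_n} :=
  [set G : graph 'I_n | `[< X _ G >]]%SET.

(* As usual, 2^{o(n log n)} is an upper bound: a class with no graph on n
   vertices for all large n is subfactorial.  If the slices are nonempty then
   their logarithms are nonnegative, and "<=" and "=" define the same classes. *)
Definition subfactorial (R : realType) (X : graph_class) : Prop :=
  exists2 e : nat -> R,
    e =o_\oo (fun n : nat => n%:R * ln n%:R : R) &
    forall n : nat, #|slice X n|%:R <= 2 `^ e n.

Definition clique_plus_isolated (T : finType) (G : graph T) : Prop :=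
  exists A : {set T},
    forall x y : T, x != y -> G x y = (x \in A) && (y \in A).

Fact clique_plus_isolated_iso (T U : finType) (G : graph T) (H : graph U) :
  graph_iso G H -> clique_plus_isolated G -> clique_plus_isolated H.
Proof.
move=> [f [g fK gK] GH] [A hA]; exists [set u | g u \in A]%SET => x y xy.
rewrite -[x in LHS]gK -[y in LHS]gK -GH hA ?inE //.
by rewrite (can_eq gK).
Qed.

Definition class_C : graph_class := GraphClass clique_plus_isolated_iso.

Definition boolean_function_of (T : finType) (k : nat) (G : graph T)
    (H : 'I_k -> graph T) : Prop :=
  exists f : {ffun 'I_k -> bool} -> bool,
    forall a b : T, a != b -> G a b = f [ffun i => H i a b].

Definition k_function_of (k : nat) (Y X : graph_class) : Prop :=
  forall (T : finType) (G : graph T), Y T G ->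
    exists j : nat, exists H : 'I_j -> graph T,
      [/\ (j <= k)%N, forall i, X T (H i) & boolean_function_of G H].

Definition function_of (Y X : graph_class) : Prop :=
  exists k : nat, k_function_of k Y X.

(* Main.v *)
Require Import Defs.
From mathcomp Require Import all_boot all_order all_algebra all_fingroup.
From mathcomp Require Import all_classical all_reals all_analysis.
From mathcomp Require Import lra.

(** A class is a function of [class_C] iff the number of pairwise non-twin
    vertices in its graphs is bounded: cliques on unions of two twin classes
    recover the adjacency, and conversely [k] cliques split the vertices into
    [2 ^ k] types, which leaves at most [2 ^ (k n + 4 ^ k)] graphs on [n]
    vertices.  If the number of twin classes is unbounded, one finds arbitrarily
    large disjoint sets [W], [B] with [#|B| <= #|W|] such that the vertices of
    [W] have distinct neighbourhoods in [B]: take [B] maximizing the number of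
    neighbourhoods in [B] of the vertices outside [B].  Permuting the labels of
    [W] then gives [#|W|`!] distinct graphs on [#|W| + #|B|] vertices. *)

Set Implicit Arguments.
Unset Strict Implicit.
Unset Printing Implicit Defensive.

Import Order.TTheory GRing.Theory Num.Theory.
Import numFieldNormedType.Exports.

Local Open Scope nat_scope.

Lemma imset_section (T U : finType) (f : T -> U) (A : {set T}) :
  exists W : {set T},
    [/\ W \subset A, {in W &, injective f} & f @: W = f @: A].
Proof.
(* For [x] in [A] the default is never reached and [c x] depends only on [f x], so the fixed points
   of [c] in [A] represent each value once. *)
pose c x := odflt x [pick y in A | f y == f x].
have cP x : x \in A -> c x \in A /\ f (c x) = f x.
  move=> xA; rewrite /c; case: pickP => [y /andP[yA /eqP]//|/(_ x)].
  by rewrite xA eqxx.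
have c_eq x y : x \in A -> f x = f y -> c x = c y.
  move=> xA fxy; rewrite /c fxy; case: pickP => //= /(_ x).
  by rewrite xA fxy eqxx.
exists [set x in A | c x == x]; split.
- by apply/fintype.subsetP => x; rewrite inE => /andP[].
- move=> x y; rewrite !inE => /andP[xA /eqP cx] /andP[_ /eqP cy] fxy.
  by rewrite -cx -cy; exact: c_eq.
- apply/setP => u; apply/imsetP/imsetP => -[x].
    by rewrite inE => /andP[xA _] ->; exists x.
  move=> xA ->; have [cA fc] := cP _ xA; exists (c x) => //.
  by rewrite inE cA (c_eq _ x) ?eqxx.
Qed.

(** * Twin vertices *)

Section Graphs.
Variables (T : finType) (G : graph T).
Implicit Types (x y z u v : T) (A B S W : {set T}).

Lemma graph_sym x y : G x y = G y x.
Proof.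
have /andP[_ /forallP h] := adj_simple G.
by have /forallP/(_ y)/eqP := h x.
Qed.

Lemma graph_irrefl x : G x x = false.
Proof. by have /andP[/forallP/(_ x)/negbTE] := adj_simple G. Qed.

(** Leaving out [u] and [v] themselves lets twins be adjacent or not. *)
Definition twin u v : bool :=
  [forall z, (z != u) ==> (z != v) ==> (G z u == G z v)].

Lemma twinP u v :
  reflect (forall z, z != u -> z != v -> G z u = G z v) (twin u v).
Proof.
apply: (iffP forallP) => h z; last first.
  by apply/implyP => zu; apply/implyP => zv; rewrite h.
by move=> zu zv; have := h z; rewrite zu zv => /eqP.
Qed.

Lemma twin_sym u v : twin u v -> twin v u.
Proof. by move=> /twinP h; apply/twinP => z zv zu; rewrite h. Qed.

Lemma twin_trans v u w : twin u v -> twin v w -> twin u w.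
Proof.
move=> /twinP uv /twinP vw; apply/twinP => z zu zw.
have [zv|zv] := eqVneq z v; last by rewrite uv ?vw.
(* At [z = v] neither twin hypothesis applies; if [u != w], both sides equal [G u w]. *)
move: zu zw; rewrite zv => vu vw'; have [->//|uw] := eqVneq u w.
have /vw Guv : u != v by rewrite eq_sym.
have /uv Gwu : w != u by rewrite eq_sym.
by rewrite (graph_sym v u) Guv // graph_sym Gwu 1?graph_sym // eq_sym.
Qed.

Lemma twin_adj u v u' v' :
  twin u u' -> twin v v' -> u != v -> u' != v' -> G u v = G u' v'.
Proof.
move=> /twinP uu' /twinP vv' uv uv'.
(* Endpoints are replaced one at a time, [v] first; if [u = v'] this would pass through a loop, so
   [u] goes first, and a full swap is symmetry. *)
have [e|nuv'] := eqVneq u v'.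
  have [e'|nvu'] := eqVneq v u'; first by rewrite graph_sym e e'.
  rewrite graph_sym uu' // 1?eq_sym // graph_sym vv' //.
  by rewrite eq_sym.
by rewrite vv' // graph_sym uu' 1?graph_sym // eq_sym.
Qed.

(** * Traces on a set of vertices *)

Definition trace B u : {set T} := [set b in B | G u b].

Definition ntraces B : nat := #|trace B @: ~: B|.

Lemma traceI A B u : A \subset B -> trace B u :&: A = trace A u.
Proof.
move=> /fintype.subsetP AB; apply/setP => b; rewrite !inE.
by case: (boolP (b \in A)) => [/AB ->|_]; rewrite ?andbT ?andbF.
Qed.

Lemma traceS A B : A \subset B ->
  forall u v, trace B u = trace B v -> trace A u = trace A v.
Proof. by move=> AB u v e; rewrite -!(traceI _ AB) e. Qed.

(* Bondy: when w is added to W, at most one element of W shares its trace, and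
   one further vertex of B tells them apart. *)
Lemma small_distinguishing_set B W : {in W &, injective (trace B)} ->
  exists B0, [/\ B0 \subset B, #|B0| <= #|W| & {in W &, injective (trace B0)}].
Proof.
have [n] := ubnP #|W|; elim: n W => // n IHn W leWn inj.
have [->|[w wW]] := set_0Vmem W.
  exists finset.set0; split; [exact: finset.sub0set | by rewrite cards0 |].
  by move=> u v; rewrite inE.
have cW := cardsD1 w W; rewrite wW in cW.
have sW u : u \in W :\ w -> u \in W by rewrite inE => /andP[].
have [||B0 [sB0 cB0 inj0]] := IHn (W :\ w).
- by rewrite -ltnS; move: leWn; rewrite cW.
- by move=> u v /sW uW /sW vW; exact: inj.
have [w' /andP[w'W /eqP tw]|alone] :=
    pickP (fun w' => (w' \in W :\ w) && (trace B0 w' == trace B0 w));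
  last first.
  exists B0; split=> //; first by rewrite cW leqW.
  move=> u v uW vW; case: (eqVneq u w) (eqVneq v w) => [->|uw] [->|vw] // e.
  - by have := alone v; rewrite in_setD1 vw vW e eqxx.
  - by have := alone u; rewrite in_setD1 uw uW e eqxx.
  - by apply: inj0; rewrite ?in_setD1 ?uw ?vw.
have [b bB Gb] : exists2 b, b \in B & G w' b != G w b.
  apply: contrapT => nex; move: w'W; rewrite in_setD1 => /andP[/eqP w'w w'W].
  apply/w'w/inj => //; apply/setP => b; rewrite !inE.
  case: (boolP (b \in B)) => //= bB; apply/eqP/negPn/negP => Gb.
  by apply: nex; exists b.
have sb : B0 \subset b |: B0 by apply: finset.subsetUr.
have tb u v : trace (b |: B0) u = trace (b |: B0) v -> G u b = G v b.
  by move=> /setP/(_ b); rewrite !inE eqxx.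
(* Any u in W :\ w with the trace of w on b |: B0 would equal w'. *)
have nw u : u \in W :\ w -> trace (b |: B0) u != trace (b |: B0) w.
  move=> uW; apply: contra Gb => /eqP e.
  have <- : u = w' by apply: inj0 => //; rewrite tw; exact: traceS e.
  by apply/eqP/tb.
exists (b |: B0); split.
- by rewrite finset.subUset finset.sub1set bB.
- by rewrite cW (leq_trans (leq_card_setU _ _)) // cards1.
- move=> u v uW vW; case: (eqVneq u w) (eqVneq v w) => [->|uw] [->|vw] // e.
  + by have := nw v; rewrite in_setD1 vw vW e eqxx => /(_ isT).
  + by have := nw u; rewrite in_setD1 uw uW e eqxx => /(_ isT).
  + by apply: inj0; rewrite ?in_setD1 ?uw ?vw //; exact: traceS e.
Qed.

(* Moving z into B separates u from v, and loses no trace since z' keeps the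
   trace of z. *)
Lemma ntraces_extend B u v z z' :
  u \notin B -> v \notin B -> trace B u = trace B v ->
  z != u -> z != v -> G z u != G z v ->
  z \notin B -> z' \notin B -> z' != z -> trace B z' = trace B z ->
  ntraces B < ntraces (z |: B).
Proof.
move=> uB vB tuv zu zv Gz zB z'B z'z tz.
have sB : B \subset z |: B by apply: finset.subsetUr.
set D := trace (z |: B) @: ~: (z |: B).
have imD : [set X :&: B | X in D] = trace B @: ~: B.
  rewrite -imset_comp; apply/setP => X; apply/imsetP/imsetP => -[w].
    rewrite !inE negb_or => /andP[_ wB] -> /=; exists w; first by rewrite inE.
    by rewrite traceI.
  rewrite inE => wB ->; have [->|wz] := eqVneq w z.
    by exists z'; rewrite ?inE ?negb_or ?z'z //= traceI.
  by exists w; rewrite ?inE ?negb_or ?wz //= traceI.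
(* Without a gain, intersecting with [B] would be injective on [D], so [u] and [v] would agree at
   [z]. *)
rewrite ltnNge; apply: contra Gz => le_D.
have /imset_injP inj : #|[set X :&: B | X in D]| == #|D|.
  by rewrite eqn_leq leq_imset_card imD.
have inD w : w \notin B -> z != w -> trace (z |: B) w \in D.
  by move=> wB zw; apply: imset_f; rewrite !inE negb_or eq_sym zw.
have := inj _ _ (inD _ uB zu) (inD _ vB zv).
rewrite !traceI // => /(_ tuv)/setP/(_ z).
by rewrite !inE eqxx /= ![G _ z]graph_sym => ->.
Qed.

Definition twin_free W : Prop := {in W &, forall u v, twin u v -> u = v}.

(* Let S be the vertices outside B that share their trace with no other.  By
   maximality only elements of S tell apart vertices with equal traces on B, so
   B :|: S distinguishes the remaining twin-free vertices. *)
Lemma card_twin_free_setD B W : (forall B', ntraces B' <= ntraces B) ->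
  twin_free W -> #|W :\: B| <= 2 * ntraces B.
Proof.
move=> maxB freeW.
pose S := [set u in ~: B | [forall v in ~: B,
  (trace B v == trace B u) ==> (v == u)]].
have SB u : u \in S -> u \in ~: B by rewrite inE => /andP[].
have leS : #|S| <= ntraces B.
  rewrite -(@card_in_imset _ _ (trace B)) ?subset_leq_card //.
    by apply/imsetS/fintype.subsetP.
  move=> u v uS; rewrite inE => /andP[_ /forall_inP/(_ _ (SB _ uS))/implyP].
  by move=> + e; rewrite e eqxx => /(_ isT)/eqP.
have leR : #|W :\: (B :|: S)| <= ntraces B.
  apply: leq_trans (maxB (B :|: S)).
  rewrite -(@card_in_imset _ _ (trace (B :|: S))) ?subset_leq_card //.
    by apply/imsetS/fintype.subsetP => u; rewrite !inE => /andP[].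
  move=> u v; rewrite !finset.in_setD !finset.in_setU !negb_or.
  move=> /andP[/andP[uB uS] uW] /andP[/andP[vB vS] vW] tuv.
  apply: freeW => //; apply/twinP => z zu zv; apply/eqP/negPn/negP => Gz.
  have zBS : (z \in B :|: S) = false.
    apply: contraNF Gz => zBS; move/setP: tuv => /(_ z).
    by rewrite ![z \in trace _ _]inE zBS /= ![G _ z]graph_sym => ->.
  move/negbT: zBS; rewrite finset.in_setU negb_or => /andP[zB].
  rewrite inE finset.in_setC zB /= => /forall_inPn[z'].
  rewrite finset.in_setC negb_imply => z'B /andP[/eqP tz z'z].
  have tuvB := traceS (finset.subsetUl B S) tuv.
  have := ntraces_extend uB vB tuvB zu zv Gz zB z'B z'z tz.
  by rewrite ltnNge maxB.
rewrite mul2n -addnn; apply: leq_trans (leq_add leS leR).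
apply: leq_trans (leq_card_setU _ _); apply: subset_leq_card.
apply/fintype.subsetP => u.
rewrite !finset.in_setU !finset.in_setD finset.in_setU.
by case: (u \in S); case: (u \in B).
Qed.

End Graphs.

(* Shrinking a maximizer of ntraces to a set B that still distinguishes its
   representatives W keeps it a maximizer, but bounds #|B| by #|W|. *)
Lemma distinguishing_pair (T : finType) (G : graph T) (A : {set T}) :
  twin_free G A -> exists W B : {set T},
    [/\ [disjoint W & B], {in W &, injective (trace G B)}, #|B| <= #|W|
      & #|A| <= 3 * #|W|].
Proof.
move=> freeA.
have [B1 _ maxB1] :=
  @arg_maxnP _ (finset.set0 : {set T}) xpredT (ntraces G) isT.
have [W [WB1 injW imW]] := imset_section (trace G B1) (~: B1).
have [B [sB cB injB]] := small_distinguishing_set injW.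
have cW : #|W| = ntraces G B1 by rewrite /ntraces -imW card_in_imset.
have sBC : ~: B1 \subset ~: B by rewrite finset.setCS.
have leB : #|W| <= ntraces G B.
  rewrite -(card_in_imset injB) subset_leq_card // imsetS //.
  exact: fintype.subset_trans WB1 sBC.
have eB : ntraces G B = #|W|.
  by apply/eqP; rewrite eqn_leq leB cW andbT; exact: maxB1.
exists W, B; split=> //.
  by rewrite finset.disjoints_subset; exact: fintype.subset_trans WB1 sBC.
have leD : #|A :\: B| <= 2 * #|W|.
  rewrite -eB; apply: card_twin_free_setD => // B'.
  by rewrite eB cW; exact: maxB1.
(* The factor 3: twice [#|W|] outside [B], and at most [#|B| <= #|W|] inside. *)
rewrite -(cardsID B A) [3 * _]mulSn leq_add //.
by apply: leq_trans cB; apply: subset_leq_card; exact: finset.subsetIr.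
Qed.

(** * Counting relabelled copies of a graph *)

Fact pullback_subproof (T U : finType) (G : graph U) (h : T -> U) :
  simple_adj [ffun p : T * T => G (h p.1) (h p.2)].
Proof.
apply/andP; split; apply/forallP => x; first by rewrite ffunE graph_irrefl.
by apply/forallP => y; rewrite !ffunE graph_sym.
Qed.

Definition pullback (T U : finType) (G : graph U) (h : T -> U) : graph T :=
  Graph (pullback_subproof G h).

Lemma pullbackE (T U : finType) (G : graph U) (h : T -> U) x y :
  pullback G h x y = G (h x) (h y).
Proof. by rewrite /adj /= ffunE. Qed.

(** Along an injection the pullback is an isomorphic copy of the subgraph induced on the image. *)
Lemma hereditary_pullback (X : graph_class) (T U : finType) (G : graph U)
    (h : T -> U) :
  hereditary X -> injective h -> X _ G -> X _ (pullback G h).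
Proof.
move=> hX hinj XG; pose A := h @: [set: T].
have hA x : h x \in A by apply: imset_f; rewrite inE.
pose g x : {y | y \in A} := exist _ (h x) (hA x).
have ginj : injective g by move=> x y /(congr1 val) /hinj.
have [|f gK fK] := inj_card_bij ginj.
  by rewrite card_sig /= (card_imset _ hinj) cardsT.
apply: class_iso (hX _ _ A XG); exists f; first by exists g.
move=> x y; rewrite pullbackE /adj /= ffunE /=.
by rewrite -[x in LHS]fK -[y in LHS]fK.
Qed.

(* Permuting W inside W :|: B yields pairwise distinct labelled graphs, since
   the trace on the fixed set B tells which vertex of W carries a label. *)
Lemma fact_le_card_slice (X : graph_class) (T : finType) (G : graph T)
    (W B : {set T}) :
  hereditary X -> X _ G -> [disjoint W & B] ->
  {in W &, injective (trace G B)} ->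
  (#|W|)`! <= #|slice X #|W :|: B| |.
Proof.
move=> hX XG dWB injB; rewrite -card_perm.
pose F (s : {perm T}) : graph 'I_#|W :|: B| :=
  pullback G (fun i => s (enum_val i)).
rewrite -(@card_in_imset _ _ F) ?subset_leq_card //.
  apply/fintype.subsetP => _ /imsetP[s _ ->]; rewrite inE; apply/asboolP.
  by apply: hereditary_pullback => // i j /perm_inj/enum_val_inj.
move=> s t Ws Wt Fst; apply/permP => w.
have [wW|wW] := boolP (w \in W); last by rewrite !(out_perm _ wW).
have onU x : x \in W :|: B -> exists i : 'I_#|W :|: B|, x = enum_val i.
  by move=> xU; exists (enum_rank_in xU x); rewrite enum_rankK_in.
apply: injB; rewrite ?perm_closed //; apply/setP => b; rewrite !inE.
have [bB|//] := boolP (b \in B).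
have bW : b \notin W by rewrite (disjointFl dWB).
have [|i wi] := onU w; first by rewrite inE wW.
have [|j bj] := onU b; first by rewrite inE bB orbT.
(* Both permutations fix [b], so [j] labels it in both graphs, and their equality makes [s w] and
   [t w] agree at [b]. *)
have := congr1 (fun H : graph _ => H i j) Fst.
by rewrite !pullbackE -wi -bj (out_perm Ws bW) (out_perm Wt bW).
Qed.

(** * Functions of [class_C]: construction from twin classes, and counting *)

Lemma twin_representatives (T : finType) (G : graph T) : exists A : {set T},
  twin_free G A /\ forall x, exists2 a, a \in A & twin G a x.
Proof.
have free0 : `[< twin_free G finset.set0 >].
  by apply/asboolP => u v; rewrite inE.
(* A vertex without a twin in a maximum twin-free set could be added to it. *)
have [A /asboolP freeA maxA] :=
  arg_maxnP (P := fun A => `[< twin_free G A >])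
    (fun A : {set T} => #|A|) free0.
exists A; split=> // x; apply: contrapT => nex.
have nx a : a \in A -> ~ twin G a x by move=> aA ax; apply: nex; exists a.
have xA : x \notin A by apply/negP => /nx; apply; apply/twinP.
suff /asboolP/maxA : twin_free G (x |: A) by rewrite /= cardsU1 xA /= ltnn.
move=> u v; rewrite !inE => /orP[/eqP->|uA] /orP[/eqP->|vA] //.
- by move=> /twin_sym /(nx _ vA).
- by move=> /(nx _ uA).
- exact: freeA.
Qed.

Fact clique_subproof (T : finType) (A : {set T}) :
  simple_adj [ffun p : T * T => [&& p.1 != p.2, p.1 \in A & p.2 \in A]].
Proof.
apply/andP; split; apply/forallP => x; first by rewrite ffunE /= eqxx.
by apply/forallP => y; rewrite !ffunE /= (eq_sym x) (andbC (x \in A)) eqxx.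
Qed.

Definition clique (T : finType) (A : {set T}) : graph T :=
  Graph (clique_subproof A).

Lemma cliqueE (T : finType) (A : {set T}) x y :
  x != y -> clique A x y = (x \in A) && (y \in A).
Proof. by move=> xy; rewrite /adj /= ffunE /= xy. Qed.

(* The cliques on the union of two types, evaluated at a, b, determine the
   unordered pair of types of a and b. *)
Lemma boolean_function_of_types (T P : finType) (G : graph T) (t : T -> P) :
  (forall a b a' b', a != b -> a' != b' -> t a = t a' -> t b = t b' ->
     G a b = G a' b') ->
  exists2 H : 'I_#|{: P * P}| -> graph T,
    forall i, class_C _ (H i) & boolean_function_of G H.
Proof.
move=> tG.
pose H (i : 'I_#|{: P * P}|) :=
  clique [set x | t x \in [:: (enum_val i).1; (enum_val i).2]].
exists H; first by move=> i; eexists => x y; exact: cliqueE.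
pose vec a b := [ffun i => H i a b].
have vecP a b a' b' : a != b -> a' != b' -> vec a b = vec a' b' ->
    t a' \in [:: t a; t b] /\ t b' \in [:: t a; t b].
  move=> ab ab' /ffunP /(_ (enum_rank (t a, t b))).
  rewrite !ffunE /H !cliqueE // !inE enum_rankK /= !eqxx !orbT /=.
  by move=> /esym/andP.
exists (fun v => [exists a, exists b, [&& a != b, vec a b == v & G a b]]).
move=> a b ab.
apply/idP/existsP => [Gab|[a' /existsP[b' /and3P[ab' /eqP e Gab']]]].
  by exists a; apply/existsP; exists b; rewrite ab Gab eqxx.
(* [vecP] in both directions gives the same pair of types up to order. *)
have [tt|[ta tb]] : (t a = t a' /\ t b = t b') \/ (t a = t b' /\ t b = t a').
  have [+ +] := vecP _ _ _ _ ab' ab e.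
  have [+ +] := vecP _ _ _ _ ab ab' (esym e).
  rewrite !inE => /orP[]/eqP a1 /orP[]/eqP b1 /orP[]/eqP a2 /orP[]/eqP b2;
    by [left; split; congruence | right; split; congruence].
  by rewrite (tG _ _ a' b') //; case: tt.
by rewrite graph_sym (tG _ _ a' b') // eq_sym.
Qed.

(** The type of a vertex is a twin of it in a twin-free set of representatives; types determine
    adjacency, and there are at most [m * m] pairs of them. *)
Lemma function_of_class_C_bounded_twin_free (X : graph_class) (m : nat) :
  (forall (T : finType) (G : graph T) (A : {set T}),
     X _ G -> twin_free G A -> #|A| <= m) ->
  function_of X class_C.
Proof.
move=> Xm; exists (m * m) => T G XG.
have [A [freeA /= reprA]] := twin_representatives G.
have [t tP] : exists t : T -> {a | a \in A}, forall x, twin G (val (t x)) x.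
  suff /boolp.choice[t tP] :
      forall x, exists a : {a | a \in A}, twin G (val a) x.
    by exists t.
  by move=> x; have [a aA ax] := reprA x; exists (exist _ a aA).
have [|H HC GH] := @boolean_function_of_types T {a | a \in A} G t.
  move=> a b a' b' ab ab' ta tb.
  apply: twin_adj => //.
    by apply: twin_trans (tP a'); rewrite -ta; exact/twin_sym.
  by apply: twin_trans (tP b'); rewrite -tb; exact/twin_sym.
exists #|{: {a | a \in A} * {a | a \in A}}|, H; split=> //.
by rewrite card_prod card_sig leq_mul // (Xm _ _ _ XG freeA).
Qed.

(** A graph is encoded by [k] membership bits per vertex and a table of adjacency over pairs of
    membership vectors. *)
Lemma card_slice_function_of_class_C (X : graph_class) (k n : nat) :
  k_function_of k X class_C -> #|slice X n| <= 2 ^ (k * n + 2 ^ k * 2 ^ k).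
Proof.
move=> Xk; pose P := {ffun 'I_k -> bool}.
pose D := ({ffun 'I_n -> P} * {ffun P * P -> bool})%type.
pose describes (d : D) (G : graph 'I_n) :=
  forall a b, a != b -> G a b = d.2 (d.1 a, d.1 b).
have descr (G : graph 'I_n) : exists d : D, X _ G -> describes d G.
  have [XG|nXG] := pselect (X _ G); last first.
    by exists ([ffun=> [ffun=> false]], [ffun=> false]).
  have [j [H [jk HC [f fG]]]] := Xk _ _ XG.
  have [A HA] := boolp.choice HC.
  (* With only [j <= k] cliques, the spare bits are set to false and the table ignores them. *)
  exists ([ffun a => [ffun i : 'I_k =>
             if insub (val i) is Some i' then a \in A i' else false]],
          [ffun p : P * P => f [ffun i =>
              p.1 (widen_ord jk i) && p.2 (widen_ord jk i)]]).
  move=> _ a b ab; rewrite fG // !ffunE; congr f; apply/ffunP => i.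
  by rewrite !ffunE (HA i _ _ ab) /= valK.
have [F FP] := boolp.choice descr.
have injF : {in slice X n &, injective F}.
  move=> G H; rewrite !inE => XG XH e.
  have dG := FP _ XG; have dH := FP _ XH.
  apply/val_inj/ffunP => -[a b]; change (G a b = H a b).
  have [->|ab] := eqVneq a b; first by rewrite !graph_irrefl.
  by rewrite dG // dH // e.
rewrite -(card_in_imset injF); apply: leq_trans (max_card _) _.
rewrite card_prod !card_ffun card_prod card_ffun !card_ord card_bool.
by rewrite expnD !expnM.
Qed.

Local Open Scope ring_scope.

(** * Asymptotic estimates *)

Section Asymptotics.
Variable R : realType.

Lemma near_ln_ge (M : R) : \forall n \near \oo%classic, M <= ln n%:R.
Proof.
near=> n; have Mn : expR M <= n%:R by near: n; exact: nbhs_infty_ger.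
by rewrite -[M]expRK ler_ln ?posrE ?expR_gt0 // (lt_le_trans (expR_gt0 M)).
Unshelve. all: by end_near. Qed.

(** A single term of the exponential series gives [r ^ r / r! <= e ^ r]. *)
Lemma mul_ln_le_ln_fact (r : nat) : r%:R * ln r%:R - r%:R <= ln (r`!)%:R :> R.
Proof.
case: r => [|r]; first by rewrite mul0r sub0r oppr0 fact0 ln1.
have r0 : 0 < r.+1%:R :> R by rewrite ltr0n.
have f0 : 0 < (r.+1`!)%:R :> R by rewrite ltr0n fact_gt0.
have h : r.+1%:R ^+ r.+1 / (r.+1`!)%:R <= expR r.+1%:R :> R.
  by apply: le_trans (expR_ge1Dxn r (ltW r0)); rewrite lerDr.
rewrite lerBlDr -ler_expR expRD lnK ?posrE //.
by rewrite mulrC expRM_natr lnK ?posrE // mulrC -ler_pdivrMr.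
Qed.

Lemma card_slice_lt_fact (X : graph_class) : subfactorial R X ->
  exists r0 : nat, forall r N : nat, (r0 <= r)%N -> (r <= N)%N ->
    (N <= 2 * r)%N -> (#|slice X N| < r`!)%N.
Proof.
(* Once [ln r >= 2], the factor [8^-1] on [N ln N <= 2 r (1 + ln r)] leaves at most [3/8 r ln r],
   while [ln r! >= r ln r - r >= 1/2 r ln r]. *)
move=> [e /eqoP /(_ 8^-1 ltac:(by []))[r1 _ eo] Xe].
have [r2 _ lnr] := near_ln_ge 2.
exists (maxn r1 (maxn r2 1)) => r N.
rewrite !geq_max => /and3P[r1r r2r r0] rN Nr.
rewrite ltnNge; apply/negP; rewrite -(ler_nat R) => le.
have ln2 : ln 2 <= 1 :> R by have := @le_ln1Dx R 1 ltac:(lra).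
have ln20 : 0 <= ln 2 :> R by apply: ln_ge0; lra.
have N0 : (0 < N)%N by exact: leq_trans rN.
have r0R : 0 < r%:R :> R by rewrite ltr0n.
have N0R : 0 < N%:R :> R by rewrite ltr0n.
have NrR : N%:R <= 2 * r%:R :> R by rewrite -natrM ler_nat.
have lnN : ln N%:R <= ln 2 + ln r%:R :> R.
  by rewrite -lnM ?posrE // ler_ln ?posrE // mulr_gt0.
have lnN0 : 0 <= ln N%:R :> R by rewrite ln_ge0 // ler1n.
have := lnr r r2r; rewrite /= => lnr2.
have := eo N (leq_trans r1r rN).
rewrite /= (ger0_norm (mulr_ge0 (ltW N0R) lnN0)) => eN.
have lef : ln (r`!)%:R <= e N * ln 2 :> R.
  rewrite -ln_powR ler_ln ?posrE ?powR_gt0 ?ltr0n ?fact_gt0 //.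
  exact: le_trans le (Xe N).
have eN1 : e N * ln 2 <= `|e N|.
  apply: le_trans (ler_norm _) _; rewrite normrM (ger0_norm ln20).
  by rewrite ler_piMr.
have NlnN : N%:R * ln N%:R <= 2 * r%:R * (1 + ln r%:R) :> R.
  by apply: ler_pM => //; apply: le_trans lnN _; rewrite lerD2r.
have := mul_ln_le_ln_fact r.
have : 2 * r%:R <= r%:R * ln r%:R :> R by rewrite mulrC ler_pM2l.
lra.
Qed.

Lemma subfactorial_function_of_class_C (X : graph_class) :
  function_of X class_C -> subfactorial R X.
Proof.
move=> [k Xk]; pose c := (k + 2 ^ k * 2 ^ k)%N.
exists (fun n => (k * n + 2 ^ k * 2 ^ k)%:R); last first.
  move=> n; rewrite powR_mulrn // -natrX ler_nat.
  exact: card_slice_function_of_class_C.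
apply/eqoP => eps eps0; near=> n.
have n0 : (0 < n)%N by near: n; exact: nbhs_infty_ge.
(* As [n >= 1], the exponent is at most [c n], which this threshold bounds by [eps n ln n]. *)
have cn : c%:R / eps <= ln n%:R by near: n; exact: near_ln_ge.
have ln0 : 0 <= ln n%:R :> R by rewrite ln_ge0 // ler1n.
rewrite !ger0_norm ?mulr_ge0 //.
apply: (@le_trans _ _ (c * n)%:R).
  by rewrite ler_nat mulnDl leq_add2l leq_pmulr.
rewrite natrM mulrCA [leLHS]mulrC ler_wpM2l //.
by rewrite mulrC -ler_pdivrMr.
Unshelve. all: by end_near. Qed.

End Asymptotics.

Theorem theorem4p17 (R : realType) (X : graph_class) (hX : hereditary X) :
  subfactorial R X <-> function_of X class_C.
Proof.
split; last exact: subfactorial_function_of_class_C.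
move=> /card_slice_lt_fact[r0 Xr].
(* A twin-free set larger than [3 * r0] would force [#|W| >= r0], with at least [#|W|] factorial
   graphs on at most [2 * #|W|] vertices. *)
apply: (@function_of_class_C_bounded_twin_free _ (3 * r0)) => T G A XG freeA.
rewrite leqNgt; apply/negP => r0A.
have [W [B [dWB injB BW AW]]] := distinguishing_pair freeA.
have cWB : #|W :|: B| = (#|W| + #|B|)%N.
  by rewrite cardsU finset.disjoint_setI0 // cards0 subn0.
have := fact_le_card_slice hX XG dWB injB; rewrite leqNgt => /negP; apply.
apply: Xr; rewrite ?cWB ?leq_addr //; last by rewrite mul2n -addnn leq_add2l.
by have := leq_trans r0A AW; rewrite ltn_mul2l => /ltnW.
Qed.
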